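(* Consider the state-space model, the backward-factorized variational distributions with separate parameters $\phi_1,\phi_2,\dots$ for each time step, the reparameterization maps $\xi_t$ and $\beta_t$, the functions $V_t^{\theta,\phi_{1:t}}$, $r_{t+1}^{\theta,\phi_{t:t+1}}$ and the evidence lower bound $\mathcal{L}_t(\theta,\phi_{1:t})$ defined in the context, under the regularity assumption stated there. Then for all $t\ge1$ $$\nabla_{\phi_t}\mathcal{L}_t(\theta,\phi_{1:t})=\nabla_{\phi_t}\mathbb{E}_{q_t^{\phi_t}(x_t)}\left[V_t^{\theta,\phi_{1:t}}(x_t)\right]=\mathbb{E}_{\lambda(\epsilon_t)}\left[\nabla_{\phi_t}V_t^{\theta,\phi_{1:t}}(\xi_t(\phi_t;\epsilon_t))\right].$$ Additionally, for all $t\ge1$, writing $x_{t+1}=\xi_{t+1}(\phi_{t+1};\epsilon_{t+1})$ as a function of $\phi_{t+1}$ and $\epsilon_{t+1}$, one has $$\begin{aligned}\nabla_{\phi_{t+1}}V_{t+1}^{\theta,\phi_{1:t+1}}\big(\xi_{t+1}(\phi_{t+1};\epsilon_{t+1})\big)=\mathbb{E}_{\lambda(\epsilon_t)}\Big[&T_t^{\theta,\phi_{1:t}}\big(\beta_t(\phi_{t+1};\epsilon_t,\xi_{t+1}(\phi_{t+1};\epsilon_{t+1}))\big)\,\frac{\mathrm{d}\beta_t(\phi_{t+1};\epsilon_t,\xi_{t+1}(\phi_{t+1};\epsilon_{t+1}))}{\mathrm{d}\phi_{t+1}}\\&+\nabla_{\phi_{t+1}}r_{t+1}^{\theta,\phi_{t:t+1}}\big(\beta_t(\phi_{t+1};\epsilon_t,\xi_{t+1}(\phi_{t+1};\epsilon_{t+1})),\,\xi_{t+1}(\phi_{t+1};\epsilon_{t+1})\big)\Big],\end{aligned}$$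 where $T_t^{\theta,\phi_{1:t}}(x_t):=\frac{\partial}{\partial x_t}V_t^{\theta,\phi_{1:t}}(x_t)$ satisfies, for all $t\ge1$, the forward recursion $$T_{t+1}^{\theta,\phi_{1:t+1}}(x_{t+1})=\mathbb{E}_{\lambda(\epsilon_t)}\left[T_t^{\theta,\phi_{1:t}}\big(\beta_t(\phi_{t+1};\epsilon_t,x_{t+1})\big)\frac{\partial\beta_t(\phi_{t+1};\epsilon_t,x_{t+1})}{\partial x_{t+1}}+\nabla_{x_{t+1}}r_{t+1}^{\theta,\phi_{t:t+1}}\big(\beta_t(\phi_{t+1};\epsilon_t,x_{t+1}),x_{t+1}\big)\right].$$ Here $\frac{\mathrm{d}\beta_t}{\mathrm{d}\phi_{t+1}}$ and $\frac{\partial\beta_t}{\partial x_{t+1}}$ are Jacobians of appropriate dimensions.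
   Context: State-space model: states $x_t\in\mathbb{R}^{d_x}$, observations $y_t\in\mathcal{Y}$ (fixed), parameter $\theta\in\mathbb{R}^{d_\theta}$; $\mu_\theta(x_1)$ is the initial density, $f_\theta(x_{t+1}|x_t)$ the transition density and $g_\theta(y_t|x_t)$ the observation density. Write $y^t=(y_1,\dots,y_t)$ and $$p_\theta(x_{1:t},y^t)=\mu_\theta(x_1)g_\theta(y_1|x_1)\prod_{k=2}^t f_\theta(x_k|x_{k-1})g_\theta(y_k|x_k).$$ Variational family: for each $t\geq 1$ there is a separate (Euclidean) parameter $\phi_t$, a probability density $q_t^{\phi_t}(x_t)$ on $\mathbb{R}^{d_x}$ and, for $t\ge2$, a conditional probability density (backward kernel) $q_t^{\phi_t}(x_{t-1}|x_t)$. Define $$q_t^{\phi_{1:t}}(x_{1:t})=q_t^{\phi_t}(x_t)\prod_{k=1}^{t-1}q_{k+1}^{\phi_{k+1}}(x_k|x_{k+1}),\qquad q_t^{\phi_{1:t}}(x_{1:t-1}|x_t)=\prod_{k=1}^{t-1}q_{k+1}^{\phi_{k+1}}(x_k|x_{k+1}).$$ Evidence lower bound: $\mathcal{L}_t(\theta,\phi_{1:t}):=\mathbb{E}_{q_t^{\phi_{1:t}}(x_{1:t})}\left[\log\big(p_\theta(x_{1:t},y^t)/q_t^{\phi_{1:t}}(x_{1:t})\big)\right]$. Value function: $V_t^{\theta,\phi_{1:t}}(x_t):=\mathbb{E}_{q_t^{\phi_{1:t}}(x_{1:t-1}|x_t)}\left[\log\big(p_\theta(x_{1:t},y^t)/q_t^{\phi_{1:t}}(x_{1:t})\big)\right]$,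 with $V_1^{\theta,\phi_1}(x_1)=\log(p_\theta(x_1,y_1)/q_1^{\phi_1}(x_1))$. Reward, for $t\ge1$: $$r_{t+1}^{\theta,\phi_{t:t+1}}(x_t,x_{t+1}):=\log\frac{f_\theta(x_{t+1}|x_t)\,g_\theta(y_{t+1}|x_{t+1})\,q_t^{\phi_t}(x_t)}{q_{t+1}^{\phi_{t+1}}(x_t|x_{t+1})\,q_{t+1}^{\phi_{t+1}}(x_{t+1})}.$$ Reparameterization: $\lambda(\epsilon)$ is a fixed probability distribution not depending on any parameter. For each $t\ge1$ there are maps $\xi_t(\phi_t;\epsilon)$ and $\beta_t(\phi_{t+1};\epsilon,x_{t+1})$ with values in $\mathbb{R}^{d_x}$ such that, when $\epsilon\sim\lambda$, $\xi_t(\phi_t;\epsilon)\sim q_t^{\phi_t}(x_t)$ and, for each $x_{t+1}$, $\beta_t(\phi_{t+1};\epsilon,x_{t+1})\sim q_{t+1}^{\phi_{t+1}}(x_t|x_{t+1})$. The notation $\mathbb{E}_{\lambda(\epsilon_t)}$ means expectation over $\epsilon_t\sim\lambda$ with all other variables (in particular $\epsilon_{t+1}$) held fixed. Derivative conventions: gradients of scalar functions are row vectors. $\nabla_{\phi_t}V_t^{\theta,\phi_{1:t}}(\xi_t(\phi_t;\epsilon_t))$, $\frac{\mathrm{d}\beta_t(\cdot)}{\mathrm{d}\phi_{t+1}}$ and $\nabla_{\phi_{t+1}}r_{t+1}^{\theta,\phi_{t:t+1}}(\cdot,\cdot)$ are total derivatives, accounting both for explicit dependence on the parameter and for dependence through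 the reparameterized arguments, with $\phi_{1:t-1}$ (respectively $\phi_{1:t}$) and the noise variables held constant; $\nabla_{x_{t+1}}r_{t+1}^{\theta,\phi_{t:t+1}}(\beta_t(\phi_{t+1};\epsilon_t,x_{t+1}),x_{t+1})$ is the total derivative in $x_{t+1}$, including through $\beta_t$. Regularity assumption (standing): all densities are strictly positive, all displayed expectations (and those of each summand) are finite, the log-densities, the functions $V_t^{\theta,\phi_{1:t}}$, $r_{t+1}^{\theta,\phi_{t:t+1}}$ and the maps $\xi_t,\beta_t$ are differentiable in the state and variational-parameter variables, and differentiation with respect to $\phi_t$, $\phi_{t+1}$ and $x_{t+1}$ may be interchanged with the expectations over $\epsilon_t$ with respect to $\lambda$. *)

(* Defs.v *)
From HB Require Import structures.
From mathcomp Require Import all_boot all_order all_algebra.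
From mathcomp Require Import all_classical all_reals all_analysis.

Set Implicit Arguments.
Unset Strict Implicit.
Unset Printing Implicit Defensive.

Import Order.TTheory GRing.Theory Num.Theory.
Import numFieldNormedType.Exports.

Local Open Scope classical_set_scope.
Local Open Scope ring_scope.

(* R^n carries the product sigma-algebra generated by the n coordinates (i.e.
   its Borel sigma-algebra); this mirrors the library's instance on tuples. *)
Section measurable_rV.
Context {R : realType} {n : nat}.

Let coors (i : 'I_n) (v : 'rV[R]_n) : measurableTypeR R := v ord0 i.

Let rV_set0 : g_sigma_preimage coors set0.
Proof. exact: sigma_algebra0. Qed.

Let rV_setC A : g_sigma_preimage coors A -> g_sigma_preimage coors (~` A).
Proof. exact: sigma_algebraC. Qed.

Let rV_bigcup (F : (set 'rV[R]_n)^nat) :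
  (forall i, g_sigma_preimage coors (F i)) ->
  g_sigma_preimage coors (\bigcup_i (F i)).
Proof. exact: sigma_algebra_bigcup. Qed.

HB.instance Definition _ := @isMeasurable.Build default_measure_display
  'rV[R]_n (g_sigma_preimage coors) rV_set0 rV_setC rV_bigcup.

Lemma measurable_coord_rV (i : 'I_n) :
  measurable_fun [set: 'rV[R]_n] (fun v => v ord0 i : measurableTypeR R).
Proof.
move=> _ A mA; rewrite setTI; apply: sub_sigma_algebra => /=.
rewrite -bigcup_seq/=; exists i => /=; first by rewrite mem_index_enum.
by exists A => //; rewrite setTI.
Qed.

Lemma measurable_fun_rVP d (T : measurableType d) (f : T -> 'rV[R]_n) :
  (forall i, measurable_fun [set: T] (fun t => f t ord0 i : measurableTypeR R)) ->
  measurable_fun [set: T] f.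
Proof.
move=> mf; suff prefS : g_sigma_preimage (fun i => coors i \o f) `<=` measurable.
  move=> _ A mA; apply: prefS.
  by rewrite g_sigma_preimage_comp; exists A.
apply: smallest_sub; first exact: sigma_algebra_measurable.
rewrite -bigcup_seq; apply: bigcup_sub => i _ A [B mB <-].
exact: (mf i).
Qed.

End measurable_rV.

Section image_measure.
Context d d' (T1 : measurableType d) (T2 : measurableType d') (R : realType).
Variable m : {sigma_finite_measure set T1 -> \bar R}.
Variables (f : T1 -> T2) (g : T2 -> T1).
Hypotheses (mf : measurable_fun [set: T1] f) (mg : measurable_fun [set: T2] g).
Hypothesis fK : cancel f g.

Let image := pushforward m f.

Let image0 : image set0 = 0%E.
Proof. by exact: measure0. Qed.

Let image_ge0 A : (0 <= image A)%E.
Proof. exact: measure_ge0. Qed.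

Let image_sigma_additive : semi_sigma_additive image.
Proof. exact: measure_semi_sigma_additive. Qed.

HB.instance Definition _ := isMeasure.Build _ _ _ image
  image0 image_ge0 image_sigma_additive.

Let image_sigma_finite : sigma_finite setT image.
Proof.
have [F FT mF] := sigma_finiteT m.
exists (fun k => g @^-1` F k).
  by rewrite -preimage_bigcup -FT preimage_setT.
move=> k; have [mFk Fkoo] := mF k; split.
  by rewrite -[X in measurable X]setTI; exact: mg.
rewrite /image /pushforward -comp_preimage.
by rewrite (_ : g \o f = id) //; apply/funext => x /=; rewrite fK.
Qed.

HB.instance Definition _ := Measure_isSigmaFinite.Build _ _ _ image
  image_sigma_finite.

(* The left inverse g serves only to transport sigma-finiteness. *)
Definition image_measure : {sigma_finite_measure set T2 -> \bar R} := image.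

End image_measure.

(* The library's sigma-finite instance on m1 \x m2 is shadowed by its instance
   for subprobabilities, hence this wrapper. *)
Section product_sigma_finite.
Local Open Scope ereal_scope.
Context d1 d2 (T1 : measurableType d1) (T2 : measurableType d2) (R : realType).
Variable m1 : {sigma_finite_measure set T1 -> \bar R}.
Variable m2 : {sigma_finite_measure set T2 -> \bar R}.

Definition prod_sf : set (T1 * T2) -> \bar R := m1 \x m2.

HB.instance Definition _ := Measure.copy prod_sf (m1 \x m2).

Let prod_sf_sigma_finite : sigma_finite setT prod_sf.
Proof.
have /sigma_finiteP[F [TF ndF Foo]] := sigma_finiteT m1.
have /sigma_finiteP[G [TG ndG Goo]] := sigma_finiteT m2.
exists (fun n => F n `*` G n).
  rewrite -setXTT TF TG predeqE => -[x y]; split.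
    move=> [/= [n _ Fnx] [k _ Gky]]; exists (maxn n k) => //; split.
    - by move: x Fnx; exact/subsetPset/ndF/leq_maxl.
    - by move: y Gky; exact/subsetPset/ndG/leq_maxr.
  by move=> [n _ []/= ? ?]; split; exists n.
move=> k; have [? ?] := Foo k; have [? ?] := Goo k.
split; first exact: measurableX.
by rewrite /prod_sf product_measure1E// lte_mul_pinfty// ge0_fin_numE.
Qed.

HB.instance Definition _ := Measure_isSigmaFinite.Build _ _ _ prod_sf
  prod_sf_sigma_finite.

End product_sigma_finite.

Section power_measure.
Context d (T : measurableType d) (R : realType).
Variable m : {sigma_finite_measure set T -> \bar R}.

Definition tuple_snoc n (p : n.-tuple T * T) : n.+1.-tuple T :=
  [tuple of rcons p.1 p.2].

Definition tuple_unsnoc n (s : n.+1.-tuple T) : n.-tuple T * T :=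
  ([tuple tnth s (widen_ord (leqnSn n) i) | i < n], tnth s ord_max).

Lemma tuple_snocK n : cancel (@tuple_snoc n) (@tuple_unsnoc n).
Proof.
move=> [s x]; rewrite /tuple_unsnoc /tuple_snoc /=; congr (_, _).
  apply: eq_from_tnth => i; rewrite tnth_mktuple (tnth_nth x) /= nth_rcons.
  by rewrite size_tuple ltn_ord (tnth_nth x).
by rewrite (tnth_nth x) /= nth_rcons size_tuple ltnn eqxx.
Qed.

Lemma measurable_tuple_snoc n :
  measurable_fun [set: n.-tuple T * T] (@tuple_snoc n).
Proof.
apply/measurable_fun_tnthP => i.
have [ilt|ige] := ltnP i n.
  rewrite (_ : _ \o _ = (@tnth n T ^~ (Ordinal ilt)) \o fst).
    by apply: measurableT_comp => //; exact: measurable_tnth.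
  apply/funext => -[s x] /=.
  by rewrite (tnth_nth x) /= nth_rcons size_tuple ilt (tnth_nth x).
rewrite (_ : _ \o _ = snd) //; apply/funext => -[s x] /=.
have -> : i = ord_max by apply/val_inj/eqP; rewrite /= eqn_leq ige -ltnS ltn_ord.
by rewrite (tnth_nth x) /= nth_rcons size_tuple ltnn eqxx.
Qed.

Lemma measurable_tuple_unsnoc n :
  measurable_fun [set: n.+1.-tuple T] (@tuple_unsnoc n).
Proof.
apply: measurable_fun_pair; last exact: measurable_tnth.
apply/measurable_fun_tnthP => i.
rewrite (_ : _ \o _ = @tnth n.+1 T ^~ (widen_ord (leqnSn n) i)).
  exact: measurable_tnth.
by apply/funext => s /=; rewrite tnth_mktuple.
Qed.

Fixpoint power_measure n : {sigma_finite_measure set (n.-tuple T) -> \bar R} :=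
  match n with
  | 0%N => @dirac _ (0.-tuple T) [tuple] R
  | n'.+1 => image_measure (prod_sf (power_measure n') m)
      (@measurable_tuple_snoc n') (@measurable_tuple_unsnoc n')
      (@tuple_snocK n')
  end.

End power_measure.

Section lebesgue_rV.
Context (R : realType) (n : nat).

Definition rV_of_tuple (s : n.-tuple (measurableTypeR R)) : 'rV[R]_n :=
  \row_i tnth s i.

Definition tuple_of_rV (v : 'rV[R]_n) : n.-tuple (measurableTypeR R) :=
  [tuple v ord0 i | i < n].

Lemma rV_of_tupleK : cancel rV_of_tuple tuple_of_rV.
Proof. by move=> s; apply: eq_from_tnth => i; rewrite tnth_mktuple mxE. Qed.

Lemma measurable_rV_of_tuple : measurable_fun setT rV_of_tuple.
Proof.
apply: measurable_fun_rVP => i.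
rewrite (_ : (fun _ => _) = @tnth n (measurableTypeR R) ^~ i).
  exact: measurable_tnth.
by apply/funext => s; rewrite mxE.
Qed.

Lemma measurable_tuple_of_rV : measurable_fun setT tuple_of_rV.
Proof.
apply/measurable_fun_tnthP => i.
rewrite (_ : _ \o _ = fun v : 'rV[R]_n => v ord0 i).
  exact: measurable_coord_rV.
by apply/funext => v /=; rewrite tnth_mktuple.
Qed.

Definition lebesgue_rV : {sigma_finite_measure set 'rV[R]_n -> \bar R} :=
  image_measure (power_measure (@lebesgue_measure R) n)
    measurable_rV_of_tuple measurable_tuple_of_rV rV_of_tupleK.

End lebesgue_rV.

Section calculus.
Context {R : realType}.

Definition grad n (f : 'rV[R]_n -> R) (x : 'rV[R]_n) : 'rV[R]_n :=
  \row_i 'd f x (delta_mx ord0 i).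

(* The library's ['J f x] acts on row vectors from the right; the transpose is
   the usual Jacobian, with entry (i, j) the derivative of the i-th component
   in the j-th variable, so that the chain rule reads
   grad (g \o f) x = grad g (f x) *m Jac f x. *)
Definition Jac n m (f : 'rV[R]_n -> 'rV[R]_m) (x : 'rV[R]_n) : 'M[R]_(m, n) :=
  ('J f x)^T.

Context d (E : measurableType d) (lambda : probability E R).

Definition integrable_rV n (F : E -> 'rV[R]_n) :=
  forall i, lambda.-integrable setT (fun e => (F e ord0 i)%:E).

Definition expect_rV n (F : E -> 'rV[R]_n) : 'rV[R]_n :=
  \row_i \int[lambda]_e F e ord0 i.

Definition interchange n (h : 'rV[R]_n -> E -> R) (u : 'rV[R]_n) : Prop :=
  [/\ differentiable (fun v => \int[lambda]_e h v e) u,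
      integrable_rV (fun e => grad (h ^~ e) u) &
      grad (fun v => \int[lambda]_e h v e) u =
      expect_rV (fun e => grad (h ^~ e) u)].

End calculus.

Definition is_density d (T : measurableType d) (R : realType)
    (m : {measure set T -> \bar R}) (p : T -> R) : Prop :=
  [/\ measurable_fun setT p, forall x, 0 <= p x &
      (\int[m]_x (p x)%:E = 1)%E].

Definition is_cond_density d d' (S : measurableType d) (T : measurableType d')
    (R : realType) (m : {measure set T -> \bar R}) (p : S -> T -> R) : Prop :=
  measurable_fun setT (fun z : S * T => p z.1 z.2) /\
  forall s, is_density m (p s).

Definition has_law d d' (E : measurableType d) (T : measurableType d')
    (R : realType) (lambda : probability E R) (m : {measure set T -> \bar R})
    (Z : E -> T) (p : T -> R) : Prop :=
  measurable_fun setT Z /\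
  forall A, measurable A ->
    (pushforward lambda Z A = \int[m]_(x in A) (p x)%:E)%E.

(* Time is counted from 0: index [t : nat] stands for time t+1, so that "for
   all t >= 1" becomes "for all t : nat", a path x_{1:t+1} is a
   [t.+1.-tuple] whose k-th entry [x`_k] is x_{k+1}, and y_{t+1} is [y t]. *)

Record state_space_model (R : realType) (dx dth : nat) (d : measure_display)
    (Y : measurableType d) (nu : {measure set Y -> \bar R}) := StateSpaceModel {
  init_pdf : 'rV[R]_dth -> 'rV[R]_dx -> R ;
  (* [trans_pdf theta x x'] is f_theta(x' | x) *)
  trans_pdf : 'rV[R]_dth -> 'rV[R]_dx -> 'rV[R]_dx -> R ;
  (* [obs_pdf theta x y] is g_theta(y | x) *)
  obs_pdf : 'rV[R]_dth -> 'rV[R]_dx -> Y -> R ;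
  init_pdfP : forall theta, is_density (lebesgue_rV R dx) (init_pdf theta) ;
  trans_pdfP : forall theta,
    is_cond_density (lebesgue_rV R dx) (trans_pdf theta) ;
  obs_pdfP : forall theta, is_cond_density nu (obs_pdf theta) }.

(* [dphi t] is the dimension of the parameter phi_{t+1}. *)
Record variational_family (R : realType) (dx : nat) (dphi : nat -> nat) :=
  VariationalFamily {
  marg_pdf : forall t, 'rV[R]_(dphi t) -> 'rV[R]_dx -> R ;
  (* backward kernel from time index t.+1 to t:
     [back_pdf t u x' x] is q_{t+2}^u(x_{t+1} = x | x_{t+2} = x') *)
  back_pdf : forall t, 'rV[R]_(dphi t.+1) -> 'rV[R]_dx -> 'rV[R]_dx -> R ;
  marg_pdfP : forall t u, is_density (lebesgue_rV R dx) (@marg_pdf t u) ;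
  back_pdfP : forall t u, is_cond_density (lebesgue_rV R dx) (@back_pdf t u) }.

Arguments marg_pdf {R dx dphi} _ t u x.
Arguments back_pdf {R dx dphi} _ t u x' x.

Record reparameterization (R : realType) (dx : nat) (dphi : nat -> nat)
    (Q : variational_family R dx dphi) (d : measure_display)
    (E : measurableType d) (lambda : probability E R) := Reparameterization {
  xi : forall t, 'rV[R]_(dphi t) -> E -> 'rV[R]_dx ;
  beta : forall t, 'rV[R]_(dphi t.+1) -> E -> 'rV[R]_dx -> 'rV[R]_dx ;
  xi_law : forall t u,
    has_law lambda (lebesgue_rV R dx) (@xi t u) (marg_pdf Q t u) ;
  beta_law : forall t u x',
    has_law lambda (lebesgue_rV R dx) (fun e => @beta t u e x')
      (back_pdf Q t u x') }.

Arguments xi {R dx dphi Q d E lambda} _ t u e.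
Arguments beta {R dx dphi Q d E lambda} _ t u e x'.

Definition update (R : realType) (dphi : nat -> nat)
    (phi : forall t, 'rV[R]_(dphi t)) (t : nat) (u : 'rV[R]_(dphi t)) :
    forall t, 'rV[R]_(dphi t) :=
  @dfwith _ (fun k => 'rV[R]_(dphi k)) phi t u.
Arguments update {R dphi} phi t u.

Section objective.
Context (R : realType) (dx dth : nat) (dphi : nat -> nat).
Context (dY : measure_display) (Y : measurableType dY).
Context (nu : {measure set Y -> \bar R}).
Variables (M : state_space_model dx dth nu) (Q : variational_family R dx dphi).
Variables (y : nat -> Y) (theta : 'rV[R]_dth).
Implicit Type phi : forall t, 'rV[R]_(dphi t).

(* The parameter sequence is passed whole; the objects of time index t only read
   its entries up to t (up to t.+1 for the reward). *)

Definition path_measure n :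
    {sigma_finite_measure set (n.-tuple 'rV[R]_dx) -> \bar R} :=
  power_measure (lebesgue_rV R dx) n.

Definition joint_pdf t (x : t.+1.-tuple 'rV[R]_dx) : R :=
  init_pdf M theta x`_0 * obs_pdf M theta x`_0 (y 0%N) *
  \prod_(k < t) (trans_pdf M theta x`_k x`_k.+1 *
                 obs_pdf M theta x`_k.+1 (y k.+1)).

(* q_{t+1}(x_{1:t} | x_{t+1}), the last entry x`_t being x_{t+1} *)
Definition var_cond_pdf phi t (x : t.+1.-tuple 'rV[R]_dx) : R :=
  \prod_(k < t) back_pdf Q k (phi k.+1) x`_k.+1 x`_k.

Definition var_pdf phi t (x : t.+1.-tuple 'rV[R]_dx) : R :=
  marg_pdf Q t (phi t) x`_t * var_cond_pdf phi x.

Definition log_ratio phi t (x : t.+1.-tuple 'rV[R]_dx) : R :=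
  ln (joint_pdf x / var_pdf phi x).

Definition elbo phi t : R :=
  \int[path_measure t.+1]_x (var_pdf phi x * log_ratio phi x).

(* For t = 0 the integral is over the one-point space of 0-tuples with unit
   mass. *)
Definition value phi t (xt : 'rV[R]_dx) : R :=
  \int[path_measure t]_z (var_cond_pdf phi [tuple of rcons z xt] *
                          log_ratio phi [tuple of rcons z xt]).

Definition expected_value phi t : R :=
  \int[lebesgue_rV R dx]_x (marg_pdf Q t (phi t) x * value phi t x).

(* r_{t+2}(x, x'), between the states at time indices t and t.+1 *)
Definition reward phi t (x x' : 'rV[R]_dx) : R :=
  ln (trans_pdf M theta x x' * obs_pdf M theta x' (y t.+1) *
      marg_pdf Q t (phi t) x /
      (back_pdf Q t (phi t.+1) x' x * marg_pdf Q t.+1 (phi t.+1) x')).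

Definition grad_value phi t (x : 'rV[R]_dx) : 'rV[R]_dx :=
  grad (value phi t) x.

End objective.

Section regularity.
Context (R : realType) (dx dth : nat) (dphi : nat -> nat).
Context (dY dE : measure_display) (Y : measurableType dY).
Context (nu : {measure set Y -> \bar R}) (E : measurableType dE).
Context (lambda : probability E R).
Variables (M : state_space_model dx dth nu) (Q : variational_family R dx dphi).
Variables (rep : reparameterization Q lambda).
Variables (y : nat -> Y) (theta : 'rV[R]_dth).
Implicit Type phi : forall t, 'rV[R]_(dphi t).

Local Notation X := 'rV[R]_dx.
Local Notation xi := (xi rep).
Local Notation beta := (beta rep).
Local Notation V := (value M Q y theta).
Local Notation r := (reward M Q y theta).
Local Notation T := (grad_value M Q y theta).

Record positive_densities : Prop := PositiveDensities {
  init_gt0 : forall x, 0 < init_pdf M theta x ;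
  trans_gt0 : forall x x', 0 < trans_pdf M theta x x' ;
  obs_gt0 : forall x z, 0 < obs_pdf M theta x z ;
  marg_gt0 : forall t u x, 0 < marg_pdf Q t u x ;
  back_gt0 : forall t u x' x, 0 < back_pdf Q t u x' x }.

Record finite_expectations : Prop := FiniteExpectations {
  elbo_finite : forall phi t,
    (path_measure R dx t.+1).-integrable setT
      (fun x => (var_pdf Q phi x * log_ratio M Q y theta phi x)%:E) ;
  value_finite : forall phi t xt,
    (path_measure R dx t).-integrable setT
      (fun z => (var_cond_pdf Q phi [tuple of rcons z xt] *
                 log_ratio M Q y theta phi [tuple of rcons z xt])%:E) ;
  expected_value_finite : forall phi t,
    (lebesgue_rV R dx).-integrable setT
      (fun x => (marg_pdf Q t (phi t) x * V phi t x)%:E) ;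
  (* the summands of the expectations over the noise at time t *)
  next_value_finite : forall phi t x',
    lambda.-integrable setT
      (fun e => (V phi t (beta t (phi t.+1) e x'))%:E) ;
  next_reward_finite : forall phi t x',
    lambda.-integrable setT
      (fun e => (r phi t (beta t (phi t.+1) e x') x')%:E) ;
  value_dphi_finite : forall phi t e',
    integrable_rV lambda (fun e =>
      T phi t (beta t (phi t.+1) e (xi t.+1 (phi t.+1) e')) *m
      Jac (fun u => beta t u e (xi t.+1 u e')) (phi t.+1)) ;
  reward_dphi_finite : forall phi t e',
    integrable_rV lambda (fun e =>
      grad (fun u => r (update phi t.+1 u) t
                       (beta t u e (xi t.+1 u e')) (xi t.+1 u e'))
        (phi t.+1)) ;
  value_dx_finite : forall phi t x',
    integrable_rV lambda (fun e =>
      T phi t (beta t (phi t.+1) e x') *m Jac (beta t (phi t.+1) e) x') ;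
  reward_dx_finite : forall phi t x',
    integrable_rV lambda (fun e =>
      grad (fun x => r phi t (beta t (phi t.+1) e x) x) x') }.

(* Joint differentiability in the listed arguments; the value function at time
   index t is only ever differentiated in phi t and in the state. *)
Record differentiability : Prop := Differentiability {
  init_diff : forall x, differentiable (fun x : X => ln (init_pdf M theta x)) x ;
  trans_diff : forall z,
    differentiable (fun z : X * X => ln (trans_pdf M theta z.1 z.2)) z ;
  obs_diff : forall t x,
    differentiable (fun x : X => ln (obs_pdf M theta x (y t))) x ;
  marg_diff : forall t z,
    differentiable
      (fun z : 'rV[R]_(dphi t) * X => ln (marg_pdf Q t z.1 z.2)) z ;
  back_diff : forall t z,
    differentiable (fun z : 'rV[R]_(dphi t.+1) * (X * X) =>
      ln (back_pdf Q t z.1 z.2.1 z.2.2)) z ;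
  value_diff : forall phi t z,
    differentiable
      (fun z : 'rV[R]_(dphi t) * X => V (update phi t z.1) t z.2) z ;
  reward_diff : forall phi t z,
    differentiable
      (fun z : ('rV[R]_(dphi t) * 'rV[R]_(dphi t.+1)) * (X * X) =>
        r (update (update phi t z.1.1) t.+1 z.1.2) t z.2.1 z.2.2) z ;
  xi_diff : forall t e u, differentiable (fun u => xi t u e) u ;
  beta_diff : forall t e z,
    differentiable
      (fun z : 'rV[R]_(dphi t.+1) * X => beta t z.1 e z.2) z }.

Record interchangeability : Prop := Interchangeability {
  interchange_value : forall phi t,
    interchange lambda (fun u e => V (update phi t u) t (xi t u e)) (phi t) ;
  interchange_next_dphi : forall phi t e',
    interchange lambda
      (fun u e => V phi t (beta t u e (xi t.+1 u e')) +
                  r (update phi t.+1 u) t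
                    (beta t u e (xi t.+1 u e')) (xi t.+1 u e'))
      (phi t.+1) ;
  interchange_next_dx : forall phi t x',
    interchange lambda
      (fun x e => V phi t (beta t (phi t.+1) e x) +
                  r phi t (beta t (phi t.+1) e x) x)
      x' }.

Definition regularity_assumption : Prop :=
  [/\ positive_densities, finite_expectations, differentiability &
      interchangeability].

End regularity.

(* Main.v *)
Require Import Defs.
From mathcomp Require Import all_boot all_order all_algebra.
From mathcomp Require Import all_classical all_reals all_analysis.
From mathcomp Require Import measurable_realfun ring.

Set Implicit Arguments.
Unset Strict Implicit.
Unset Printing Implicit Defensive.

Import Order.TTheory GRing.Theory Num.Theory.
Import numFieldNormedType.Exports.

Local Open Scope classical_set_scope.
Local Open Scope ring_scope.

(* Appending a state to a path multiplies the joint density by f g and the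
   backward density by one kernel, so the log-ratio of the longer path is the
   log-ratio of the shorter one plus the reward. Integrating out all states but
   the last (Fubini, each backward kernel having mass one) gives
     V_{t+1}(x') = E_{q_{t+1}(x | x')}[V_t(x) + r_{t+1}(x, x')],
   and the ELBO is the q_t-expectation of V_t. After moving the expectations to
   the noise space, the gradients pass under the integral sign by assumption,
   and the chain rule, with V_t independent of phi_{t+1}, gives the formulas. *)

(** * Integration against densities and against laws given by densities *)

Section density.
Local Open Scope ereal_scope.
Context d (T : measurableType d) (R : realType).
Variables (m nu : {measure set T -> \bar R}) (p : T -> R).
Hypothesis mp : measurable_fun setT p.
Hypothesis p0 : forall x, (0 <= p x)%R.
Hypothesis nuE : forall A, measurable A -> nu A = \int[m]_(x in A) (p x)%:E.

Import HBNNSimple.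

(** Both sides are limits, by monotone convergence, along the same increasing simple approximations
    of [f], so [nuE] enters only on their level sets. *)
Lemma ge0_integral_density (f : T -> \bar R) :
  measurable_fun setT f -> (forall x, 0 <= f x) ->
  \int[nu]_x f x = \int[m]_x ((p x)%:E * f x).
Proof.
move=> mf f0; pose h := nnsfun_approx measurableT mf.
have hcvg x : (EFin \o h^~ x) @ \oo --> f x by exact: cvg_nnsfun_approx.
have ndh x a b : (a <= b)%N -> (h a x <= h b x)%R.
  by move=> ab; exact/lefP/nd_nnsfun_approx.
transitivity (lim (\int[nu]_x (EFin \o h n) x @[n --> \oo])).
  under eq_integral => x _ do rewrite -(cvg_lim _ (hcvg x))//.
  apply: monotone_convergence => //.
  - by move=> n; exact/measurable_EFinP.
  - by move=> n x _; rewrite lee_fin.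
  - by move=> x _ a b ab; rewrite lee_fin ndh.
transitivity (lim (\int[m]_x ((p x)%:E * (h n x)%:E) @[n --> \oo])); last first.
  rewrite -monotone_convergence//.
  - apply: eq_integral => x _; apply/cvg_lim => //.
    by apply: cvgeZl => //; exact: hcvg.
  - move=> n; apply: emeasurable_funM; first exact/measurable_EFinP.
    exact/measurable_EFinP.
  - by move=> n x _; rewrite -EFinM lee_fin mulr_ge0.
  - by move=> x _ a b ab; rewrite -!EFinM lee_fin ler_wpM2l ?ndh.
congr (lim (_ @ \oo)); apply/funext => n /=.
have mpre r : measurable (h n @^-1` [set r]) by [].
rewrite integralT_nnsfun sintegralE.
transitivity (\sum_(r \in range (h n))
    \int[m]_x ((p x)%:E * (r * \1_(h n @^-1` [set r]) x)%:E)); last first.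
  rewrite -ge0_integral_fsum//; last 2 first.
  - move=> r; apply: emeasurable_funM; first exact/measurable_EFinP.
    by apply/measurable_EFinP; exact: measurable_funM.
  - move=> r x _; rewrite -EFinM lee_fin mulr_ge0//.
    have := nnfun_muleindic_ge0 (h n) r x; rewrite -EFinM lee_fin; exact.
  apply: eq_integral => x _.
  rewrite [h n x in RHS](fimfunE (h n) x) -fsumEFin//.
  rewrite ge0_mule_fsumr// => r.
  by have := nnfun_muleindic_ge0 (h n) r x; rewrite -EFinM.
(* A value of [h n] is nonnegative, so it can be carried under the integral once [nuE] has turned
   the measure of its level set into an integral of [p]. *)
apply: eq_fsbigr => r /[!inE] -[x _ <-]; rewrite nuE// integral_mkcond.
rewrite -ge0_integralZl ?lee_fin//; last 2 first.
- apply/(measurable_restrictT _ _).1 => //.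
  exact/measurable_EFinP/measurable_funTS.
- by move=> z _; rewrite erestrict_ge0// => ? _; rewrite lee_fin.
by apply: eq_integral => z _; rewrite epatch_indic/= EFinM muleCA.
Qed.

(** Multiplication by the nonnegative [p x] commutes with positive and negative parts, so the
    nonnegative case applies to each part. *)
Lemma integral_density (f : T -> \bar R) :
  measurable_fun setT f ->
  \int[nu]_x f x = \int[m]_x ((p x)%:E * f x).
Proof.
move=> mf; rewrite integralE [RHS]integralE; congr (_ - _).
- rewrite ge0_integral_density//; last exact: measurable_funepos.
  apply: eq_integral => x _; rewrite !funeposE.
  by rewrite maxe_pMr ?lee_fin// mule0.
- rewrite ge0_integral_density//; last exact: measurable_funeneg.
  apply: eq_integral => x _; rewrite !funenegE -muleN.
  by rewrite maxe_pMr ?lee_fin// mule0.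
Qed.

End density.

Section law.
Context d d' (E : measurableType d) (T : measurableType d') (R : realType).
Variables (lambda : probability E R) (m : {measure set T -> \bar R}).

(** By [has_law] the image of [lambda] under [Z] has density [p]; the change of variables is made on
    the positive and negative parts of [g]. *)
Lemma integral_law (Z : E -> T) (p g : T -> R) :
  is_density m p -> has_law lambda m Z p -> measurable_fun setT g ->
  (\int[lambda]_e (g (Z e))%:E = \int[m]_x (p x * g x)%:E)%E.
Proof.
move=> [mp p0 _] [mZ law] mg.
have mEg : measurable_fun setT (EFin \o g) by exact/measurable_EFinP.
under [RHS]eq_integral do rewrite EFinM.
rewrite -(@integral_density _ _ _ m (pushforward lambda Z) p mp p0 law
  (EFin \o g))//.
rewrite [LHS]integralE [RHS]integralE; congr (_ - _)%E.
  rewrite ge0_integral_pushforward//; last exact: measurable_funepos.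
  by rewrite preimage_setT -funepos_comp.
rewrite ge0_integral_pushforward//; last exact: measurable_funeneg.
by rewrite preimage_setT -funeneg_comp.
Qed.

Lemma Rintegral_law (Z : E -> T) (p g : T -> R) :
  is_density m p -> has_law lambda m Z p -> measurable_fun setT g ->
  \int[lambda]_e g (Z e) = \int[m]_x (p x * g x).
Proof. by move=> dp law mg; rewrite /Rintegral (integral_law dp law). Qed.

End law.

(** * Fubini on path space, with the last state integrated outermost *)

Section power_measure.
Context d (T : measurableType d) (R : realType).
Variable m : {sigma_finite_measure set T -> \bar R}.
Local Notation pm := (power_measure m).

Lemma ge0_integral_power_measureS n (F : n.+1.-tuple T -> \bar R) :
  measurable_fun setT F -> (forall s, 0 <= F s)%E ->
  (\int[pm n.+1]_s F s = \int[m]_x \int[pm n]_z F [tuple of rcons z x])%E.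
Proof.
move=> mF F0.
have mS := @measurable_tuple_snoc _ T n.
transitivity (\int[(pm n) \x m]_z (F \o @tuple_snoc _ T n) z)%E.
  (* [pm n.+1] unfolds to the image of [prod_sf (pm n) m] under [tuple_snoc]. *)
  exact: (@ge0_integral_pushforward _ _ _ _ _ _ mS (prod_sf (pm n) m) setT).
rewrite fubini_tonelli2//; last by move=> z; exact: F0.
exact: (measurableT_comp mF mS).
Qed.

(** Moves integrability to the product space, where Fubini applies; the integrals of the absolute
    values agree by change of variables. *)
Lemma integrable_power_measureS n (F : n.+1.-tuple T -> \bar R) :
  (pm n.+1).-integrable setT F ->
  ((pm n) \x m)%E.-integrable setT (F \o @tuple_snoc _ T n).
Proof.
move=> iF; have mF := measurable_int _ iF.
have mS := @measurable_tuple_snoc _ T n.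
apply/integrableP; split; first exact: (measurableT_comp mF mS).
have /integrableP[_] := iF; apply: le_lt_trans.
rewrite le_eqVlt; apply/orP; left; apply/eqP; symmetry.
apply: (@ge0_integral_pushforward _ _ _ _ _ _ mS (prod_sf (pm n) m) setT) => //.
exact: measurableT_comp.
Qed.

Section Rintegral.
Variables (n : nat) (F : n.+1.-tuple T -> R).
Hypothesis iF : (pm n.+1).-integrable setT (EFin \o F).
Hypothesis iFx : forall x,
  (pm n).-integrable setT (fun z => (F [tuple of rcons z x])%:E).

(** As [iFx] holds at every [x], not just almost everywhere, the [fine] hidden in the real-valued
    integral loses nothing at any point. *)
Let innerE x : (\int[pm n]_z (F [tuple of rcons z x])%:E =
  (\int[pm n]_z F [tuple of rcons z x])%:E)%E.
Proof. by rewrite /Rintegral fineK//; exact: integrable_fin_num. Qed.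

(** Part of Fubini's theorem; in [value_recursion] it supplies the measurability of the
    integrand. *)
Lemma measurable_Rintegral_power_measureS :
  measurable_fun setT (fun x => \int[pm n]_z F [tuple of rcons z x]).
Proof.
apply/measurable_EFinP.
have := measurable_fubini_G (integrable_power_measureS iF).
by congr measurable_fun; apply/funext => x; exact: innerE.
Qed.

Lemma Rintegral_power_measureS :
  \int[pm n.+1]_s F s = \int[m]_x \int[pm n]_z F [tuple of rcons z x].
Proof.
have mS := @measurable_tuple_snoc _ T n.
rewrite {1}/Rintegral [RHS]/Rintegral; congr fine.
under [RHS]eq_integral do rewrite -innerE.
have iS := integrable_power_measureS iF.
transitivity (\int[(pm n) \x m]_z (EFin \o F \o @tuple_snoc _ T n) z)%E.
  apply: (@integral_pushforward _ _ _ _ _ _ mS (prod_sf (pm n) m) setT) => //.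
  exact: measurable_int iF.
by rewrite -integral21_prod_meas1.
Qed.

End Rintegral.
End power_measure.

(** * Paths extended by one state, and division of measurable functions *)

Lemma nth_rcons_last T (x0 : T) n (z : n.-tuple T) x :
  nth x0 (rcons z x) n = x.
Proof. by rewrite nth_rcons size_tuple ltnn eqxx. Qed.

Lemma nth_rcons_lt T (x0 : T) n (z : n.-tuple T) x k :
  (k < n)%N -> nth x0 (rcons z x) k = nth x0 z k.
Proof. by move=> kn; rewrite nth_rcons size_tuple kn. Qed.

Lemma measurable_tuple_rcons d (T : measurableType d) n (x : T) :
  measurable_fun setT (fun z : n.-tuple T => [tuple of rcons z x]).
Proof.
apply: (measurableT_comp (@measurable_tuple_snoc _ T n) (g := pair^~ x)).
exact: measurable_pair2.
Qed.

(** Integrability gives measurability of a value function only after multiplication by a positive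
    density, which is divided out here. *)
Lemma measurable_mul_cancell d (T : measurableType d) (R : realType)
    (p g : T -> R) : (forall x, 0 < p x) -> measurable_fun setT p ->
  measurable_fun setT (fun x => p x * g x) -> measurable_fun setT g.
Proof.
move=> p0 mp mpg.
(* The inverse is taken as a real power, whose measurability is known. *)
rewrite (_ : g = (fun x => p x `^ (-1) * (p x * g x))).
  apply: measurable_funM => //.
  exact: measurableT_comp (measurable_powR _) mp.
by apply/funext => x; rewrite powR_inv1 ?ltW// mulKf// gt_eqF.
Qed.

(** * Telescoping of the log-ratio and recursion for the value function *)

Section model.
Context (R : realType) (dx dth : nat) (dphi : nat -> nat).
Context (dY dE : measure_display) (Y : measurableType dY).
Context (nu : {measure set Y -> \bar R}) (E : measurableType dE).
Context (lambda : probability E R).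
Variables (M : state_space_model dx dth nu) (Q : variational_family R dx dphi).
Variables (rep : reparameterization Q lambda).
Variables (y : nat -> Y) (theta : 'rV[R]_dth).
Implicit Type phi : forall t, 'rV[R]_(dphi t).
Local Notation V := (value M Q y theta).
Local Notation r := (reward M Q y theta).

Lemma var_cond_pdf_rcons phi t (z : t.+1.-tuple 'rV[R]_dx) x' :
  var_cond_pdf Q phi [tuple of rcons z x'] =
  var_cond_pdf Q phi z * back_pdf Q t (phi t.+1) x' z`_t.
Proof.
rewrite /var_cond_pdf big_ord_recr /= nth_rcons_last nth_rcons_lt//.
by congr (_ * _); apply: eq_bigr => k _; rewrite !nth_rcons_lt// ltnS// ltnW.
Qed.

Lemma joint_pdf_rcons t (z : t.+1.-tuple 'rV[R]_dx) x' :
  joint_pdf M y theta [tuple of rcons z x'] =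
  joint_pdf M y theta z *
  (trans_pdf M theta z`_t x' * obs_pdf M theta x' (y t.+1)).
Proof.
rewrite /joint_pdf big_ord_recr /= nth_rcons_last !nth_rcons_lt// mulrA.
congr (_ * _ * _); apply: eq_bigr => k _.
by rewrite !nth_rcons_lt// ltnS// ltnW.
Qed.

Lemma measurable_var_cond_pdf phi t :
  measurable_fun setT (@var_cond_pdf _ _ _ Q phi t).
Proof.
apply: measurable_prod => k _.
have [mb _] := back_pdfP Q (phi k.+1).
rewrite (_ : (fun _ => _) = (fun z => back_pdf Q k (phi k.+1) z.1 z.2) \o
  (fun x : t.+1.-tuple 'rV[R]_dx =>
    (tnth x (lift ord0 k), tnth x (widen_ord (leqnSn t) k)))).
  apply: measurableT_comp => //.
  by apply: measurable_fun_pair; exact: measurable_tnth.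
by apply/funext => x /=; rewrite !(tnth_nth 0).
Qed.

Lemma measurable_var_cond_pdf_rcons phi t (x : 'rV[R]_dx) :
  measurable_fun setT (fun z : t.-tuple _ =>
    var_cond_pdf Q phi [tuple of rcons z x] : measurableTypeR R).
Proof.
exact: measurableT_comp (measurable_var_cond_pdf phi (t := t))
  (measurable_tuple_rcons x).
Qed.

Lemma var_cond_pdf_ge0 phi t (x : t.+1.-tuple 'rV[R]_dx) :
  0 <= var_cond_pdf Q phi x.
Proof.
by apply: prodr_ge0 => k _; have [_ /(_ x`_k.+1)[]] := back_pdfP Q (phi k.+1).
Qed.

(** Once the next-to-last state is fixed, the kernel out of the last state is constant in the inner
    integral. The remaining kernels have mass one by induction, and the outer integral is the mass
    of that kernel. *)
Lemma integral_var_cond_pdf phi t (x : 'rV[R]_dx) :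
  (\int[path_measure R dx t]_z (var_cond_pdf Q phi [tuple of rcons z x])%:E
   = 1)%E.
Proof.
elim: t x => [|t IH] x'.
  rewrite /path_measure/= integral_dirac//; last first.
    by apply/measurable_EFinP; exact: measurable_var_cond_pdf_rcons.
  by rewrite diracT mul1e /var_cond_pdf big_ord0.
rewrite ge0_integral_power_measureS; last 2 first.
- by apply/measurable_EFinP; exact: measurable_var_cond_pdf_rcons.
- by move=> s; rewrite lee_fin var_cond_pdf_ge0.
have [mb /(_ x')[mbx bge0 b1]] := back_pdfP Q (phi t.+1).
rewrite -[RHS]b1; apply: eq_integral => x _.
under eq_integral do rewrite var_cond_pdf_rcons nth_rcons_last mulrC EFinM.
rewrite ge0_integralZl//.
- by rewrite IH mule1.
- by apply/measurable_EFinP; exact: measurable_var_cond_pdf_rcons.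
- by move=> z _; rewrite lee_fin var_cond_pdf_ge0.
- by rewrite lee_fin.
Qed.

Section regular.
Hypothesis pos : positive_densities M Q theta.
Hypothesis fin : finite_expectations M rep y theta.

Lemma joint_pdf_gt0 t (x : t.+1.-tuple 'rV[R]_dx) : 0 < joint_pdf M y theta x.
Proof.
apply: mulr_gt0; first by rewrite mulr_gt0 ?(init_gt0 pos) ?(obs_gt0 pos).
by apply: prodr_gt0 => k _; rewrite mulr_gt0 ?(trans_gt0 pos) ?(obs_gt0 pos).
Qed.

Lemma var_cond_pdf_gt0 phi t (x : t.+1.-tuple 'rV[R]_dx) :
  0 < var_cond_pdf Q phi x.
Proof. by apply: prodr_gt0 => k _; exact: (back_gt0 pos). Qed.

(** The marginal in the numerator of the reward cancels the one in the denominator of the shorter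
    ratio. Strict positivity allows the two logarithms to be merged. *)
Lemma log_ratio_rcons phi t (z : t.+1.-tuple 'rV[R]_dx) x' :
  log_ratio M Q y theta phi [tuple of rcons z x'] =
  log_ratio M Q y theta phi z + r phi t z`_t x'.
Proof.
have jz := joint_pdf_gt0 z; have vz := var_cond_pdf_gt0 phi z.
have mz := marg_gt0 pos (phi t) z`_t; have mx := marg_gt0 pos (phi t.+1) x'.
have bz := back_gt0 pos (phi t.+1) x' z`_t.
have tz := trans_gt0 pos z`_t x'; have ox := obs_gt0 pos x' (y t.+1).
rewrite /log_ratio /reward /var_pdf var_cond_pdf_rcons joint_pdf_rcons.
rewrite /= nth_rcons_last; move: (joint_pdf _ _ _ z) jz => j j0.
rewrite -lnM ?posrE ?(divr_gt0, mulr_gt0)//.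
congr ln; field.
by rewrite !gt_eqF.
Qed.

(** The marginal of the last state is constant in the inner integral, so it factors out and leaves
    the value function. *)
Lemma elboE phi t : elbo M Q y theta phi t = expected_value M Q y theta phi t.
Proof.
rewrite /elbo /expected_value.
have varE (z : t.-tuple _) x :
    var_pdf Q phi [tuple of rcons z x] *
      log_ratio M Q y theta phi [tuple of rcons z x] =
    marg_pdf Q t (phi t) x * (var_cond_pdf Q phi [tuple of rcons z x] *
      log_ratio M Q y theta phi [tuple of rcons z x]).
  by rewrite /var_pdf /= nth_rcons_last mulrA.
rewrite Rintegral_power_measureS.
- apply: eq_Rintegral => x _; under eq_Rintegral do rewrite varE.
  by rewrite RintegralZl//; exact: (value_finite fin).
- exact: (elbo_finite fin).
- move=> x; under eq_fun do rewrite varE EFinM.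
  by apply: integrableZl => //; exact: (value_finite fin).
Qed.

Lemma expected_valueE phi t :
  expected_value M Q y theta phi t =
  \int[lambda]_e V phi t (xi rep t (phi t) e).
Proof.
rewrite (Rintegral_law (marg_pdfP Q (phi t)) (xi_law rep (phi t)))//.
have [mm _ _] := marg_pdfP Q (phi t).
have := measurable_int _ (expected_value_finite fin phi t).
move=> /measurable_EFinP mpV.
exact: measurable_mul_cancell (marg_gt0 pos (phi t)) mm mpV.
Qed.

Lemma value_recursion phi t x' :
  V phi t.+1 x' =
  \int[lambda]_e (V phi t (beta rep t (phi t.+1) e x') +
                  r phi t (beta rep t (phi t.+1) e x') x').
Proof.
have [mb /(_ x') bd] := back_pdfP Q (phi t.+1).
have [mbx bge0 b1] := bd.
set vc := fun x (z : t.-tuple 'rV[R]_dx) =>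
  var_cond_pdf Q phi [tuple of rcons z x].
set lr := fun x (z : t.-tuple 'rV[R]_dx) =>
  log_ratio M Q y theta phi [tuple of rcons z x].
have ivc x : (path_measure R dx t).-integrable setT (EFin \o vc x).
  apply/integrableP; split.
    by apply/measurable_EFinP; exact: measurable_var_cond_pdf_rcons.
  under eq_integral do rewrite /= ger0_norm ?var_cond_pdf_ge0//.
  by rewrite integral_var_cond_pdf ltry.
have ivl x : (path_measure R dx t).-integrable setT
    (EFin \o (fun z => vc x z * lr x z)).
  exact: (value_finite fin).
(* The integrand of [V phi t.+1 x']: the path [s] stops before [x'], so its last entry is the state
   at index [t]. *)
pose F (s : t.+1.-tuple 'rV[R]_dx) :=
  var_cond_pdf Q phi [tuple of rcons s x'] *
  log_ratio M Q y theta phi [tuple of rcons s x'].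
have FE (z : t.-tuple _) x :
    F [tuple of rcons z x] = back_pdf Q t (phi t.+1) x' x *
    (vc x z * lr x z + r phi t x x' * vc x z).
  rewrite /F var_cond_pdf_rcons log_ratio_rcons /= nth_rcons_last.
  by rewrite /vc /lr; ring.
have irvc x : (path_measure R dx t).-integrable setT
    (EFin \o (fun z => r phi t x x' * vc x z)).
  exact: (integrableZl measurableT (r phi t x x') (ivc x)).
have iG x : (path_measure R dx t).-integrable setT
    (EFin \o (fun z => vc x z * lr x z + r phi t x x' * vc x z)).
  exact: (integrableD measurableT (ivl x) (irvc x)).
have iF : (path_measure R dx t.+1).-integrable setT (EFin \o F).
  exact: (value_finite fin).
have iFx x : (path_measure R dx t).-integrable setT
    (fun z => (F [tuple of rcons z x])%:E).
  under eq_fun do rewrite FE EFinM.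
  exact: (integrableZl measurableT _ (iG x)).
(* The reward depends only on the last two states, so it leaves the inner integral, multiplied by
   the total mass one of the earlier kernels. *)
have inner x : \int[path_measure R dx t]_z F [tuple of rcons z x] =
    back_pdf Q t (phi t.+1) x' x * (V phi t x + r phi t x x').
  under eq_Rintegral do rewrite FE.
  rewrite RintegralZl// RintegralD// RintegralZl//.
  rewrite [X in _ * (_ + _ * X)](_ : _ = 1) ?mulr1//.
  by rewrite /Rintegral integral_var_cond_pdf.
have mbVr := measurable_Rintegral_power_measureS iF iFx.
rewrite (Rintegral_law bd (beta_law rep (phi t.+1) x')
  (g := fun x => V phi t x + r phi t x x')).
  rewrite /value -/F (Rintegral_power_measureS iF iFx).
  by apply: eq_Rintegral => x _; rewrite inner.
(* By [inner], the kernel times [V + r] is the partial integral of [F], which is measurable. *)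
apply: measurable_mul_cancell (back_gt0 pos (phi t.+1) x') mbx _.
by under eq_fun do rewrite -inner.
Qed.

End regular.
End model.

(** * Sum and chain rules for gradients *)

Section grad.
Context {R : realType}.

Lemma gradD n (f g : 'rV[R]_n -> R) x :
  differentiable f x -> differentiable g x ->
  grad (fun v => f v + g v) x = grad f x + grad g x.
Proof.
move=> df dg; apply/rowP => i; rewrite !mxE.
by rewrite (_ : (fun v => _) = f + g)// diffD.
Qed.

(** The differential of [h] at a basis vector is expanded in the canonical basis; linearity of the
    differential of [f] then gives the matrix product entrywise. *)
Lemma grad_comp n m (f : 'rV[R]_m -> R) (h : 'rV[R]_n -> 'rV[R]_m) x :
  differentiable h x -> differentiable f (h x) ->
  grad (fun v => f (h v)) x = grad f (h x) *m Jac h x.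
Proof.
move=> dh df; apply/rowP => i; rewrite !mxE.
rewrite (_ : (fun v => _) = f \o h)// diff_comp//=.
rewrite [in LHS](row_sum_delta ('d h x (delta_mx ord0 i))) linear_sum.
apply: eq_bigr => k _; rewrite linearZ/= !mxE mulrC.
by congr (_ * _); rewrite /jacobian; rewrite mxE.
Qed.

End grad.

(** * Parameter sequences changed at one time step *)

Section update.
Context (R : realType) (dphi : nat -> nat).
Implicit Type phi : forall t, 'rV[R]_(dphi t).

Lemma update_same phi t u : update phi t u t = u.
Proof. exact: dfwithin. Qed.

Lemma update_neq phi t u k : k != t -> update phi t u k = phi k.
Proof. by move=> kt; apply: dfwithout; rewrite eq_sym. Qed.

(** Serves to evaluate the joint differentiability hypotheses, stated through [update], at the
    current parameters. *)
Lemma update_id phi t : update phi t (phi t) = phi.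
Proof.
apply: functional_extensionality_dep => k; have [->|kt] := eqVneq k t.
  exact: update_same.
exact: update_neq.
Qed.

End update.

(** This is why differentiating in [phi t.+1] sees the value at index [t] only through its state
    argument, hence only through [grad_value] times the Jacobian of [beta]. *)
Lemma value_eq (R : realType) (dx dth : nat) (dphi : nat -> nat)
    (dY : measure_display) (Y : measurableType dY)
    (nu : {measure set Y -> \bar R}) (M : state_space_model dx dth nu)
    (Q : variational_family R dx dphi) (y : nat -> Y) (theta : 'rV[R]_dth)
    (phi phi' : forall t, 'rV[R]_(dphi t)) t :
  (forall k, (k <= t)%N -> phi k = phi' k) ->
  value M Q y theta phi t = value M Q y theta phi' t.
Proof.
move=> pp; apply/funext => x; apply: eq_Rintegral => z _.
have vcE (s : t.+1.-tuple 'rV[R]_dx) :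
    var_cond_pdf Q phi s = var_cond_pdf Q phi' s.
  by apply: eq_bigr => k _; rewrite pp.
by rewrite /log_ratio /var_pdf !vcE pp.
Qed.

(** * Differentiability of the composites, from joint differentiability *)

Section smooth.
Context (R : realType) (dx dth : nat) (dphi : nat -> nat).
Context (dY dE : measure_display) (Y : measurableType dY).
Context (nu : {measure set Y -> \bar R}) (E : measurableType dE).
Context (lambda : probability E R).
Variables (M : state_space_model dx dth nu) (Q : variational_family R dx dphi).
Variables (rep : reparameterization Q lambda).
Variables (y : nat -> Y) (theta : 'rV[R]_dth).
Hypothesis diff : differentiability M rep y theta.
Variables (phi : forall t, 'rV[R]_(dphi t)) (t : nat) (e : E).

Lemma differentiable_value x : differentiable (value M Q y theta phi t) x.
Proof.
have := value_diff diff phi (phi t, x); rewrite /=.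
move=> /(differentiable_comp (f := fun v => (phi t, v))).
by rewrite /comp/= update_id; apply; exact: differentiable_pair.
Qed.

Lemma differentiable_beta_state x :
  differentiable (beta rep t (phi t.+1) e) x.
Proof.
apply: (differentiable_comp (f := fun v => (phi t.+1, v))
                            (g := fun z => beta rep t z.1 e z.2)).
  exact: differentiable_pair.
exact: (beta_diff diff).
Qed.

Lemma differentiable_beta_param e' u :
  differentiable (fun u => beta rep t u e (xi rep t.+1 u e')) u.
Proof.
apply: (differentiable_comp (f := fun u => (u, xi rep t.+1 u e'))
                            (g := fun z => beta rep t z.1 e z.2)).
  by apply: differentiable_pair => //; exact: (xi_diff diff).
exact: (beta_diff diff).
Qed.

Lemma differentiable_reward_state x :
  differentiable
    (fun x => reward M Q y theta phi t (beta rep t (phi t.+1) e x) x) x.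
Proof.
have := reward_diff diff phi
  ((phi t, phi t.+1), (beta rep t (phi t.+1) e x, x)).
move=> /(differentiable_comp
  (f := fun v => ((phi t, phi t.+1), (beta rep t (phi t.+1) e v, v)))).
rewrite /comp/= !update_id; apply.
apply: differentiable_pair => //; apply: differentiable_pair => //.
exact: differentiable_beta_state.
Qed.

Lemma differentiable_reward_param e' u :
  differentiable
    (fun u => reward M Q y theta (update phi t.+1 u) t
       (beta rep t u e (xi rep t.+1 u e')) (xi rep t.+1 u e')) u.
Proof.
(* The slot of index [t] is kept at [phi t], so the inner update is trivial and only the one at
   [t.+1] varies. *)
have := reward_diff diff phi ((phi t, u),
  (beta rep t u e (xi rep t.+1 u e'), xi rep t.+1 u e')).
move=> /(differentiable_comp (f := fun v => ((phi t, v),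
  (beta rep t v e (xi rep t.+1 v e'), xi rep t.+1 v e')))).
rewrite /comp/= !update_id; apply.
apply: differentiable_pair => //; apply: differentiable_pair => //.
  exact: differentiable_beta_param.
exact: (xi_diff diff).
Qed.

End smooth.

Theorem proposition3 (R : realType) (dx dth : nat) (dphi : nat -> nat)
    (dY dE : measure_display) (Y : measurableType dY)
    (nu : {measure set Y -> \bar R}) (E : measurableType dE)
    (lambda : probability E R)
    (M : state_space_model dx dth nu) (Q : variational_family R dx dphi)
    (rep : reparameterization Q lambda)
    (y : nat -> Y) (theta : 'rV[R]_dth)
    (reg : regularity_assumption M rep y theta)
    (phi : forall t, 'rV[R]_(dphi t)) (t : nat) :
  [/\ [/\ differentiable (fun u => elbo M Q y theta (update phi t u) t) (phi t),
          differentiable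
            (fun u => expected_value M Q y theta (update phi t u) t) (phi t),
          grad (fun u => elbo M Q y theta (update phi t u) t) (phi t) =
          grad (fun u => expected_value M Q y theta (update phi t u) t) (phi t) &
          grad (fun u => expected_value M Q y theta (update phi t u) t) (phi t) =
          expect_rV lambda (fun e =>
            grad (fun u => value M Q y theta (update phi t u) t (xi rep t u e))
              (phi t))],
      forall e' : E,
        grad (fun u => value M Q y theta (update phi t.+1 u) t.+1
                         (xi rep t.+1 u e')) (phi t.+1) =
        expect_rV lambda (fun e =>
          grad_value M Q y theta phi t
            (beta rep t (phi t.+1) e (xi rep t.+1 (phi t.+1) e')) *m
          Jac (fun u => beta rep t u e (xi rep t.+1 u e')) (phi t.+1) +
          grad (fun u => reward M Q y theta (update phi t.+1 u) t
                           (beta rep t u e (xi rep t.+1 u e'))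
                           (xi rep t.+1 u e')) (phi t.+1)) &
      forall x' : 'rV[R]_dx,
        grad_value M Q y theta phi t.+1 x' =
        expect_rV lambda (fun e =>
          grad_value M Q y theta phi t (beta rep t (phi t.+1) e x') *m
          Jac (fun x => beta rep t (phi t.+1) e x) x' +
          grad (fun x => reward M Q y theta phi t
                           (beta rep t (phi t.+1) e x) x) x')].
Proof.
case: reg => pos fin diff inter.
(* The two objectives agree as functions of [u], not only at [phi t], so their gradients agree. *)
have elboE' : (fun u => elbo M Q y theta (update phi t u) t) =
    (fun u => expected_value M Q y theta (update phi t u) t).
  by apply/funext => u; exact: (elboE fin).
have expE : (fun u => expected_value M Q y theta (update phi t u) t) =
    (fun u => \int[lambda]_e
       value M Q y theta (update phi t u) t (xi rep t u e)).
  by apply/funext => u; rewrite (expected_valueE pos fin) update_same.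
split.
- have [dV _ gV] := interchange_value inter phi t.
  by rewrite elboE' expE; split.
- move=> e'; have [_ _ gV] := interchange_next_dphi inter phi t e'.
  (* The recursion is substituted as an identity in [u], which yields exactly the integral treated
     by [interchange_next_dphi]. *)
  rewrite (_ : (fun u => value _ _ _ _ _ _ _) = (fun u => \int[lambda]_e
      (value M Q y theta phi t (beta rep t u e (xi rep t.+1 u e')) +
       reward M Q y theta (update phi t.+1 u) t
         (beta rep t u e (xi rep t.+1 u e')) (xi rep t.+1 u e')))).
    rewrite gV; congr expect_rV; apply/funext => e.
    rewrite gradD; last exact: (differentiable_reward_param diff).
      rewrite (grad_comp (f := value M Q y theta phi t))//.
        exact: (differentiable_beta_param diff).
      exact: (differentiable_value diff).
    apply: differentiable_comp; first exact: (differentiable_beta_param diff).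
    exact: (differentiable_value diff).
  (* Only entry [t.+1] moves with [u], and the value at index [t] reads entries up to [t], so its
     parameters can be reset to [phi]. *)
  apply/funext => u; rewrite (value_recursion pos fin) update_same.
  rewrite (@value_eq _ _ _ _ _ _ _ _ _ _ _ (update phi t.+1 u) phi)// => k kt.
  by rewrite update_neq// ltn_eqF.
- move=> x'; have [_ _ gV] := interchange_next_dx inter phi t x'.
  (* Here all parameters are fixed and only the state varies, so the recursion applies pointwise
     without any update. *)
  rewrite /grad_value (_ : value _ _ _ _ _ t.+1 = (fun x => \int[lambda]_e
      (value M Q y theta phi t (beta rep t (phi t.+1) e x) +
       reward M Q y theta phi t (beta rep t (phi t.+1) e x) x))).
    rewrite gV; congr expect_rV; apply/funext => e.
    rewrite gradD; last exact: (differentiable_reward_state diff).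
      rewrite (grad_comp (f := value M Q y theta phi t))//.
        exact: (differentiable_beta_state diff).
      exact: (differentiable_value diff).
    apply: differentiable_comp; first exact: (differentiable_beta_state diff).
    exact: (differentiable_value diff).
  by apply/funext => x; exact: (value_recursion pos fin).
Qed.
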